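(* Let $T$ be a t-norm and let $I\colon[0,1]^2\to[0,1]$ be the R-implication generated from $T$, i.e. $I(x,y)=\sup\{t\in[0,1] : T(x,t)\le y\}$ for all $x,y\in[0,1]$. Then $I(I(y,x),I(x,y))=I(x,y)$ for all $x,y\in[0,1]$.
   Context: A t-norm is a function $T\colon[0,1]^2\to[0,1]$ that is commutative, associative, non-decreasing in each variable, and satisfies $T(x,1)=x$ for all $x\in[0,1]$. No continuity of $T$ is assumed. *)

(* Defs.v *)
From HB Require Import structures.
From mathcomp Require Import all_boot all_order all_algebra.
From mathcomp Require Import all_classical all_reals.

Set Implicit Arguments.
Unset Strict Implicit.
Unset Printing Implicit Defensive.

Import Order.TTheory GRing.Theory Num.Theory.
Local Open Scope classical_set_scope.
Local Open Scope ring_scope.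

(* A function [0,1]^2 -> [0,1] is a total function R -> R -> R of which only
   the values on [0,1]^2 matter; every condition is relativized to [0,1]. *)
Record is_tnorm (R : realType) (T : R -> R -> R) : Prop := IsTnorm {
  tnorm_closed : forall x y : R, x \in `[0, 1] -> y \in `[0, 1] ->
    T x y \in `[0, 1];
  tnormC : forall x y : R, x \in `[0, 1] -> y \in `[0, 1] -> T x y = T y x;
  tnormA : forall x y z : R,
    x \in `[0, 1] -> y \in `[0, 1] -> z \in `[0, 1] ->
    T x (T y z) = T (T x y) z;
  tnorm_le_l : forall x x' y : R,
    x \in `[0, 1] -> x' \in `[0, 1] -> y \in `[0, 1] ->
    x <= x' -> T x y <= T x' y;
  tnorm_le_r : forall x y y' : R,
    x \in `[0, 1] -> y \in `[0, 1] -> y' \in `[0, 1] ->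
    y <= y' -> T x y <= T x y';
  tnormx1 : forall x : R, x \in `[0, 1] -> T x 1 = x
}.

Definition R_implication (R : realType) (T : R -> R -> R) (x y : R) : R :=
  sup [set t : R | t \in `[0, 1] /\ T x t <= y].

(* Main.v *)
(* Since [0,1] is totally ordered, either x <= y, and then I(x,y) = 1 and
   I(z,1) = 1 for all z, or y <= x, and then I(y,x) = 1 and I(1,z) = z for
   all z. *)
Require Import Defs.
From HB Require Import structures.
From mathcomp Require Import all_boot all_order all_algebra.
From mathcomp Require Import all_classical all_reals.

Set Implicit Arguments.
Unset Strict Implicit.
Unset Printing Implicit Defensive.

Import Order.TTheory GRing.Theory Num.Theory.
Local Open Scope ring_scope.

(** Comparing [x] and [y] makes one of the two inner implications equal to 1, and each case needs
    only a supremum that is attained: the value 1 when the premise is below the conclusion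
    ([R_implication_eq1]), or [z] when the premise is 1 ([R_implication1x]). [sup_max] evaluates
    such suprema. *)

Lemma sup_max (R : realType) (A : set R) (m : R) :
  A m -> ubound A m -> sup A = m.
Proof.
move=> Am ubm; apply/eqP; rewrite eq_le; apply/andP; split.
  by apply: ge_sup => //; exists m.
by apply: ub_le_sup => //; exists m.
Qed.

Lemma unit0 (R : realType) : (0 : R) \in `[0, 1].
Proof. by rewrite in_itv /= lexx ler01. Qed.

Lemma unit1 (R : realType) : (1 : R) \in `[0, 1].
Proof. by rewrite in_itv /= lexx ler01. Qed.

Section Tnorm.
Variables (R : realType) (T : R -> R -> R) (HT : is_tnorm T).

Lemma tnorm1x (x : R) : x \in `[0, 1] -> T 1 x = x.
Proof. by move=> hx; rewrite (tnormC HT) ?unit1// (tnormx1 HT). Qed.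

Lemma tnorm_lel (x t : R) : x \in `[0, 1] -> t \in `[0, 1] -> T x t <= x.
Proof.
move=> hx ht; rewrite -[leRHS](tnormx1 HT hx).
apply: (tnorm_le_r HT) => //; first exact: unit1.
by move: ht; rewrite in_itv => /andP[].
Qed.

Lemma tnormx0 (x : R) : x \in `[0, 1] -> T x 0 = 0.
Proof.
move=> hx; rewrite (tnormC HT) ?unit0//; apply/eqP.
rewrite eq_le tnorm_lel ?unit0//=.
have := tnorm_closed HT (unit0 R) hx.
by rewrite in_itv => /andP[].
Qed.

(** The set under the supremum is bounded by 1 and contains 0, since [T x 0 = 0]. This lets an
    implication serve as an argument of another one. *)
Lemma R_implication_closed (x y : R) : x \in `[0, 1] -> y \in `[0, 1] ->
  R_implication T x y \in `[0, 1].
Proof.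
move=> hx; rewrite !in_itv /= => /andP[y0 _].
have A0 : (0 : R) \in `[0, 1] /\ T x 0 <= y by rewrite unit0 tnormx0.
have ub1 (t : R) : t \in `[0, 1] /\ T x t <= y -> t <= 1.
  by move=> [+ _]; rewrite in_itv => /andP[].
apply/andP; split.
  by apply: ub_le_sup => //; exists 1.
by apply: ge_sup => //; exists 0.
Qed.

(** The largest candidate [t = 1] is admissible, because [T x 1 = x]. *)
Lemma R_implication_eq1 (x y : R) : x \in `[0, 1] -> x <= y ->
  R_implication T x y = 1.
Proof.
move=> hx xy; apply: sup_max => [|t [+ _]].
  by split; [exact: unit1 | rewrite (tnormx1 HT)].
by rewrite in_itv => /andP[].
Qed.

(** As [T 1 t = t], the supremum is over the interval from 0 to [z]. *)
Lemma R_implication1x (z : R) : z \in `[0, 1] -> R_implication T 1 z = z.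
Proof.
move=> hz; apply: sup_max => [|t [ht]]; last by rewrite tnorm1x.
by split; rewrite ?tnorm1x.
Qed.

End Tnorm.

Theorem theorem2p3 (R : realType) (T : R -> R -> R) (HT : is_tnorm T)
    (x y : R) (hx : x \in `[0, 1]) (hy : y \in `[0, 1]) :
  R_implication T (R_implication T y x) (R_implication T x y)
  = R_implication T x y.
Proof.
have [xy|/ltW yx] := leP x y.
  have hz := R_implication_closed HT hy hx.
  (* The outer conclusion becomes 1, which bounds the premise [R_implication T y x]. *)
  rewrite (R_implication_eq1 HT hx xy); apply: R_implication_eq1 => //.
  by move: hz; rewrite in_itv => /andP[].
rewrite (R_implication_eq1 HT hy yx); apply: R_implication1x => //.
exact: R_implication_closed.
Qed.
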